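(* Let $A=U+XY^H\in\mathbb{C}^{n\times n}$ be a proper upper Hessenberg matrix with $U$ unitary and $X,Y\in\mathbb{C}^{n\times k}$ of full rank, let $N=n+k$, and let $\hat A=\hat U+\hat X\hat Y^H\in\mathbb{C}^{N\times N}$ be the Hessenberg matrix obtained by embedding $A$ (embedding defined in the context). Let $P$ be the unitary factor of the QR factorization of $p_d(\hat A)$, where $p_d(x)$ is a monic polynomial of degree $d$. Let $\hat A^{(1)}=P^H\hat AP$ be the matrix obtained by applying a step of the multi-shifted QR algorithm to the matrix $\hat A$ with shifts being the roots of $p_d(x)$. Then $$\hat A^{(1)}=\begin{bmatrix}A^{(1)}&B^{(1)}\\0_{k,n}&0_k\end{bmatrix},$$ where $A^{(1)}$ is the matrix generated by applying one step of the multi-shifted QR algorithm to the matrix $A$ with shifts being the roots of $p_d(x)$. Both $\hat A^{(1)}$ and $A^{(1)}$ are upper Hessenberg. If $A^{(1)}$ is proper, then the factorization $\hat A^{(1)}=L^{(1)}F^{(1)}R^{(1)}$ exists with the following properties: - $L^{(1)}$ is a proper unitary $k$-lower Hessenberg matrix; - $R^{(1)}=(r^{(1)}_{ij})$ is a unitary $k$-upper Hessenberg matrix with $r^{(1)}_{i+k,i}\neq0$ for $i=1,\dots,n-1$; - $F^{(1)}=Q^{(1)}+T^{(1)}Z^{(1)H}$, where $Q^{(1)}=\begin{bmatrix}I_k&0\\0&\hat Q^{(1)}\end{bmatrix}$ is block diagonal unitary upper Hessenberg with $\hat Q^{(1)}\in\mathbb{C}^{n\times n}$ proper, $T^{(1)}=\begin{bmatrix}T^{(1)}_k\\0_{n,k}\end{bmatrix}$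 with $T_k^{(1)}\in\mathbb{C}^{k\times k}$ upper triangular, and $Z^{(1)}\in\mathbb{C}^{N\times k}$ has full rank; and, if $A$ is nonsingular, $R^{(1)}$ is also proper.
   Context: A matrix $H$ is $k$-upper Hessenberg if $h_{ij}=0$ whenever $i>j+k$, and $k$-lower Hessenberg if $h_{ij}=0$ whenever $j>i+k$; ''upper Hessenberg'' means $1$-upper Hessenberg. A $k$-upper (resp. $k$-lower) Hessenberg matrix of size $m$ is proper if $h_{j+k,j}\ne 0$ (resp. $h_{j,j+k}\neq 0$) for $1\le j\le m-k$. $M^H$ is the conjugate transpose. Embedding. Given $A=U+XY^H$ as in the claim, take the economy-size QR decomposition $Y=Q_YR_Y$ ($Q_Y\in\mathbb{C}^{n\times k}$ with orthonormal columns, $R_Y\in\mathbb{C}^{k\times k}$ upper triangular), set $\tilde Y=Q_Y$, $\tilde X=XR_Y^H$, $B=U\tilde Y$, and define $$\hat U=\begin{bmatrix}U-U\tilde Y\tilde Y^H & B\\ \tilde Y^H & 0_k\end{bmatrix},\quad \hat X=\begin{bmatrix}\tilde X+B\\ -I_k\end{bmatrix},\quad \hat Y=\begin{bmatrix}\tilde Y\\ 0_k\end{bmatrix},\quad \hat A=\hat U+\hat X\hat Y^H=\begin{bmatrix}A & B\\ 0_{k,n}&0_k\end{bmatrix}.$$ Here $\hat U$ is unitary and $\hat X,\hat Y$ have full rank. Multi-shifted QR step. One step applied to a matrix $M$, with shifts being the roots of $p_d$, produces $P^HMP$, where $P$ is the unitary factor of the QR factorization of $p_d(M)$.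
   Formalization: The unitary factor P is not unique when p_d(A) is singular, and the block form then fails for some choices; the formal theorem proves the claim for every P when p_d(A) is nonsingular, and for at least one suitable P when it is singular. *)

(* Defs.v *)
From mathcomp Require Import all_boot all_order all_algebra.
From mathcomp Require Import spectral sesquilinear reals complex.

Set Implicit Arguments.
Unset Strict Implicit.
Unset Printing Implicit Defensive.

Import GRing.Theory Num.Theory.
Local Open Scope ring_scope.
Local Open Scope sesquilinear_scope.

Section Hessenberg.
Variables (C : numClosedFieldType) (m : nat).
Implicit Types (k : nat) (H : 'M[C]_m).

Definition upper_hess k H := forall i j : 'I_m, (j + k < i)%N -> H i j = 0.

Definition lower_hess k H := forall i j : 'I_m, (i + k < j)%N -> H i j = 0.

Definition proper_upper_hess k H :=
  upper_hess k H /\ forall i j : 'I_m, i = (j + k)%N :> nat -> H i j != 0.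

Definition proper_lower_hess k H :=
  lower_hess k H /\ forall i j : 'I_m, j = (i + k)%N :> nat -> H i j != 0.

(* [is_trig_mx] is the library's *lower* triangular predicate. *)
Definition upper_triangular H := is_trig_mx H^T.

End Hessenberg.

Section QR.
Variable C : numClosedFieldType.

(* No sign normalisation of the diagonal of the triangular factor is imposed,
   so a matrix has several unitary factors: they agree up to a diagonal
   unitary right factor when the matrix is nonsingular, and may differ more
   substantially when it is singular. *)
Definition qr_unitary_factor m (M P : 'M[C]_m) :=
  P \is unitarymx /\
  exists2 R : 'M[C]_m, upper_triangular R & M = P *m R.

Definition economy_qr n k (Y QY : 'M[C]_(n, k)) (RY : 'M[C]_k) :=
  [/\ QY^t* *m QY = 1%:M, upper_triangular RY & Y = QY *m RY].

(* M1 is produced from M by one multi-shifted QR step whose shifts are the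
   roots of p. *)
Definition multishift_qr_step m (p : {poly C}) (M M1 : 'M[C]_m.+1) :=
  exists2 P : 'M[C]_m.+1, qr_unitary_factor (horner_mx M p) P
                     & M1 = P^t* *m M *m P.

End QR.

Section Embedding.
Variables (C : numClosedFieldType) (n k : nat).
Variables (U : 'M[C]_n) (X QY : 'M[C]_(n, k)) (RY : 'M[C]_k).

Definition embed_B : 'M[C]_(n, k) := U *m QY.

Definition embed_U : 'M[C]_(n + k) :=
  block_mx (U - U *m QY *m QY^t*) embed_B (QY^t*) 0.

Definition embed_X : 'M[C]_(n + k, k) :=
  col_mx (X *m RY^t* + embed_B) (- 1%:M).

Definition embed_Y : 'M[C]_(n + k, k) := col_mx QY 0.

Definition embed_A : 'M[C]_(n + k) := embed_U + embed_X *m embed_Y^t*.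

End Embedding.

Section LFR.
Variables (C : numClosedFieldType) (n k : nat).

(* The blocks of Q and T are of sizes k, n (in this order), those of the
   embedded matrices of sizes n, k, whence the casts along k + n = n + k. *)
Definition lfr_Q (Qhat : 'M[C]_n) : 'M[C]_(n + k) :=
  castmx (addnC k n, addnC k n) (block_mx 1%:M 0 0 Qhat).

Definition lfr_T (Tk : 'M[C]_k) : 'M[C]_(n + k, k) :=
  castmx (addnC k n, erefl k) (col_mx Tk 0).

Definition lfr_middle (F : 'M[C]_(n + k)) :=
  exists (Qhat : 'M[C]_n) (Tk : 'M[C]_k) (Z : 'M[C]_(n + k, k)),
  [/\ lfr_Q Qhat \is unitarymx /\ upper_hess 1 (lfr_Q Qhat),
      proper_upper_hess 1 Qhat,
      upper_triangular Tk,
      \rank Z = k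
    & F = lfr_Q Qhat + lfr_T Tk *m Z^t*].

(* In the condition on R, [j] is 0-based: its 1-based value ranges over
   1, ..., n - 1. *)
Definition lfr_factorization (M L F R : 'M[C]_(n + k)) :=
  [/\ M = L *m F *m R,
      L \is unitarymx /\ proper_lower_hess k L,
      R \is unitarymx /\ upper_hess k R,
      forall i j : 'I_(n + k),
        i = (j + k)%N :> nat -> (j.+1 < n)%N -> R i j != 0
    & lfr_middle F].

End LFR.

(* Main.v *)
(* Every relevant unitary factor is block diagonal, P = diag(P1, P2), and
   conjugation by it carries the embedding of A = U + X Y^H to the embedding of
   A1 = P1^H A P1, itself a unitary plus a rank k matrix; so it suffices to
   factor an embedded proper Hessenberg matrix V + W' W^H, with V unitary.
   If p(A) is singular, P1 is accumulated from one-shift steps, each using a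
   QR factorization of a Hessenberg matrix with a Hessenberg unitary factor.
   For the factorization, W' = [X'; -I] = L1 T is a QR factorization, and a QL
   factorization of [I; X'^H] provides a basis L2 of the orthogonal of W' whose
   top block is lower triangular and invertible. With L = [L1, L2], the last n
   rows of L^H V are those of L^H (V + W' W^H), that is [G A, *] with G upper
   triangular and invertible. If G A = Qh R1 is a QR factorization with Qh
   Hessenberg, then Q = diag(I, Qh), R = Q^H L^H V and Z = R W do the job. *)

Require Import Defs.
From mathcomp Require Import all_boot all_order all_algebra.
From mathcomp Require Import spectral sesquilinear reals complex.
From mathcomp Require Import zify.

Set Implicit Arguments.
Unset Strict Implicit.
Unset Printing Implicit Defensive.

Import GRing.Theory Num.Theory.
Local Open Scope ring_scope.
Local Open Scope sesquilinear_scope.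

(** * Conjugate transposes and unitary matrices *)

Section ConjugateTranspose.
Variable C : numClosedFieldType.

Lemma adjmxM m n p (A : 'M[C]_(m, n)) (B : 'M_(n, p)) :
  (A *m B)^t* = B^t* *m A^t*.
Proof. by rewrite trmx_mul map_mxM. Qed.

Lemma adjmxB m n (A B : 'M[C]_(m, n)) : (A - B)^t* = A^t* - B^t*.
Proof. by rewrite linearB map_mxB. Qed.

Lemma adjmx0 m n : (0 : 'M[C]_(m, n))^t* = 0.
Proof. by rewrite trmx0 map_mx0. Qed.

Lemma adjmx1 n : (1%:M : 'M[C]_n)^t* = 1%:M.
Proof. by rewrite trmx1 map_mx1. Qed.

Lemma adjmx_block m1 m2 n1 n2 (A : 'M[C]_(m1, n1)) (B : 'M_(m1, n2))
    (D : 'M_(m2, n1)) (E : 'M_(m2, n2)) :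
  (block_mx A B D E)^t* = block_mx (A^t*) (D^t*) (B^t*) (E^t*).
Proof. by rewrite tr_block_mx map_block_mx. Qed.

Lemma adjmx_col m1 m2 n (A : 'M[C]_(m1, n)) (B : 'M_(m2, n)) :
  (col_mx A B)^t* = row_mx (A^t*) (B^t*).
Proof. by rewrite tr_col_mx map_row_mx. Qed.

Lemma adjmx_row m n1 n2 (A : 'M[C]_(m, n1)) (B : 'M_(m, n2)) :
  (row_mx A B)^t* = col_mx (A^t*) (B^t*).
Proof. by rewrite tr_row_mx map_col_mx. Qed.

Lemma unitarymx_adjP n {A : 'M[C]_n} :
  reflect (A^t* *m A = 1%:M) (A \is unitarymx).
Proof.
by apply: (iffP idP) => [/unitarymxP/mulmx1C | /mulmx1C] // /unitarymxP.
Qed.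

Lemma unitarymx1 n : (1%:M : 'M[C]_n) \is unitarymx.
Proof. by apply/unitarymxP; rewrite adjmx1 mulmx1. Qed.

Lemma unitary_block_diag m n (A : 'M[C]_m) (B : 'M_n) :
  A \is unitarymx -> B \is unitarymx -> block_mx A 0 0 B \is unitarymx.
Proof.
move=> /unitarymxP hA /unitarymxP hB; apply/unitarymxP.
rewrite adjmx_block !adjmx0 mulmx_block hA hB !mulmx0 !mul0mx !addr0 add0r.
by rewrite -scalar_mx_block.
Qed.

End ConjugateTranspose.

(** * Zero patterns of Hessenberg and triangular matrices under products and blocks *)

Section Hessenberg.
Variable C : numClosedFieldType.

Lemma upper_triangularP m (R : 'M[C]_m) :
  reflect (upper_hess 0 R) (upper_triangular R).
Proof.
apply: (iffP is_trig_mxP) => hR i j ltij.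
  by have := hR j i; rewrite mxE; apply; lia.
by rewrite mxE hR // addn0.
Qed.

Lemma upper_triangular_adj m (L : 'M[C]_m) :
  is_trig_mx L -> upper_triangular (L^t*).
Proof.
move=> /is_trig_mxP hL; apply/upper_triangularP => i j ltij.
by rewrite !mxE hL ?conjC0 //; lia.
Qed.

Lemma upper_triangularM m (R S : 'M[C]_m) :
  upper_triangular R -> upper_triangular S -> upper_triangular (R *m S).
Proof.
move=> /upper_triangularP hR /upper_triangularP hS; apply/upper_triangularP.
move=> i j ltij; rewrite mxE big1 // => l _.
have [ltli|leil] := ltnP l i; first by rewrite hR ?mul0r ?addn0.
by rewrite hS ?mulr0 //; lia.
Qed.

Lemma upper_triangular_unit_diag m (R : 'M[C]_m) i :
  upper_triangular R -> R \in unitmx -> R i i != 0.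
Proof.
move=> hR; rewrite -unitmx_tr unitmxE unitfE (det_trig hR).
by move=> /prodf_neq0/(_ i isT); rewrite mxE.
Qed.

Lemma upper_hessM m a b (G H : 'M[C]_m) :
  upper_hess a G -> upper_hess b H -> upper_hess (a + b) (G *m H).
Proof.
move=> hG hH i j ltij; rewrite mxE big1 // => l _.
have [ltli|leil] := ltnP (l + a) i; first by rewrite hG ?mul0r.
by rewrite hH ?mulr0 //; lia.
Qed.

(** On the extreme diagonal the two zero patterns leave a single index in the sum: an [s] below [l]
    kills the entry of [G], an [s] above [l] that of [H]. *)
Lemma upper_hess_mul_diag m a b (G H : 'M[C]_m) (i l j : 'I_m) :
  upper_hess a G -> upper_hess b H ->
  i = (l + a)%N :> nat -> l = (j + b)%N :> nat ->
  (G *m H) i j = G i l * H l j.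
Proof.
move=> hG hH il lj; rewrite mxE (bigD1 l) //= big1 ?addr0 // => s neq_sl.
have {}neq_sl : s != l :> nat by [].
have [ltsi|leis] := ltnP (s + a) i; first by rewrite hG ?mul0r.
by rewrite hH ?mulr0 //; lia.
Qed.

(** Strong induction on the column: in entry [(i, j)] of the product, terms from earlier columns of
    [H] vanish by induction and later ones because [R] is triangular. What is left is
    [H i j * R j j], with [R j j] nonzero. *)
Lemma upper_hess_divr m a (H R : 'M[C]_m) :
  upper_triangular R -> R \in unitmx ->
  upper_hess a (H *m R) -> upper_hess a H.
Proof.
move=> hR Ru hHR i j; have [b lejb] := ubnP j; elim: b => // b IHb in j lejb *.
move=> ltij; have := hHR i j ltij.
rewrite mxE (bigD1 j) //= big1 => [|s neq_sj].
  move/eqP; rewrite addr0 mulf_eq0 => /orP[/eqP //|].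
  by rewrite (negPf (upper_triangular_unit_diag j hR Ru)).
have {}neq_sj : s != j :> nat by [].
have [ltsj|lejs] := ltnP s j; first by rewrite IHb ?mul0r //; lia.
by move/upper_triangularP: hR => hR; rewrite hR ?mulr0 //; lia.
Qed.

Lemma upper_hess_add_scalar m (H : 'M[C]_m) (x : C) :
  upper_hess 1 H -> upper_hess 1 (H + x%:M).
Proof.
move=> hH i j ltij; rewrite !mxE hH //.
have /negPf -> : i != j by apply/eqP => ij; move: ltij; rewrite ij; lia.
by rewrite addr0.
Qed.

Lemma upper_hess_block_diag a k n (H : 'M[C]_n) :
  upper_hess a H -> upper_hess a (block_mx (1%:M : 'M_k) 0 0 H).
Proof.
move=> hH i j; case: (split_ordP i) => i' ->; case: (split_ordP j) => j' ->.
all: rewrite /= ?(block_mxEul, block_mxEur, block_mxEdl, block_mxEdr) => ltij.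
- rewrite mxE; have /negPf -> // : i' != j'.
  by apply/eqP => ij; move: ltij; rewrite ij; lia.
- by rewrite mxE.
- by rewrite mxE.
- by rewrite hH //; lia.
Qed.

Lemma upper_hess_block_ul a m n (H : 'M[C]_m) (B : 'M_(m, n)) :
  upper_hess a H -> upper_hess a (block_mx H B 0 0).
Proof.
move=> hH i j; case: (split_ordP i) => i' ->; case: (split_ordP j) => j' ->.
all: rewrite /= ?(block_mxEul, block_mxEur, block_mxEdl, block_mxEdr) => ltij.
- exact: hH.
- by have := ltn_ord i'; lia.
- by rewrite mxE.
- by rewrite mxE.
Qed.

Lemma upper_triangular_block m n (R : 'M[C]_m) (B : 'M_(m, n)) (S : 'M_n) :
  upper_triangular R -> upper_triangular S ->
  upper_triangular (block_mx R B 0 S).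
Proof.
rewrite /upper_triangular tr_block_mx is_trig_block_mx // trmx0 eqxx.
by move=> -> ->.
Qed.

Lemma upper_hess_castmx a m n (e : m = n) (H : 'M[C]_m) :
  upper_hess a H -> upper_hess a (castmx (e, e) H).
Proof. by case: n / e; rewrite castmx_id. Qed.

End Hessenberg.

(** * QR factorizations and Hessenberg-preserving QR steps *)

Section QR.
Variable C : numClosedFieldType.

(** Row [i] of [A] lies in the span of the rows of [schmidt A] up to [i], and these are orthogonal
    to row [j] whenever [i < j]. *)
Lemma schmidt_lq m n (A : 'M[C]_(m, n)) : (m <= n)%N ->
  is_trig_mx (A *m (schmidt A)^t*) /\ A = A *m (schmidt A)^t* *m schmidt A.
Proof.
move=> lemn; have uS := schmidt_unitarymx A lemn; split; last first.
  by have /submxP[D {1 2}->] := schmidt_sub A; rewrite mulmxtVK.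
apply/is_trig_mxP => i j ltij.
have : (row i A <= orthomx Num.conj (mx_of_hermitian (hermitian1mx _))
                        (row j (schmidt A)))%MS.
  apply: submx_trans (row_schmidt_sub A i) _.
  apply/sumsmx_subP => l leli; rewrite genmxE.
  apply/orthomx1P; apply/matrixP => a b; rewrite !ord1.
  rewrite -dotmxE (row_unitarymxP uS) mxE.
  by have /negPf -> : l != j by apply/eqP => lj; move: leli; rewrite lj; lia.
move=> /orthomx1P/matrixP/(_ 0 0); rewrite !mxE => {2}<-.
by apply: eq_bigr => l _; rewrite !mxE.
Qed.

Lemma tall_qr p q (M : 'M[C]_(q, p)) : (p <= q)%N ->
  exists (Q : 'M_(q, p)) (R : 'M_p),
  [/\ Q^t* *m Q = 1%:M, upper_triangular R & M = Q *m R].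
Proof.
move=> lepq; have [tL eM] := schmidt_lq (M^t*) lepq.
exists ((schmidt (M^t*))^t*), ((M^t* *m (schmidt (M^t*))^t*)^t*); split.
- by rewrite trmxCK; apply/unitarymxP; exact: schmidt_unitarymx.
- exact: upper_triangular_adj.
- by rewrite -[RHS]adjmxM -eM trmxCK.
Qed.

(* Reversing the order of the columns turns a QR into a QL factorization. *)
Lemma tall_ql p q (M : 'M[C]_(q, p)) : (p <= q)%N ->
  exists (Q : 'M_(q, p)) (L : 'M_p),
  [/\ Q^t* *m Q = 1%:M, is_trig_mx L & M = Q *m L].
Proof.
move=> lepq; have [Q [R [uQ /upper_triangularP tR eM]]] :=
  tall_qr (colsub (@rev_ord p) M) lepq.
exists (colsub (@rev_ord p) Q), (mxsub (@rev_ord p) (@rev_ord p) R); split.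
- apply/matrixP => i j; have /matrixP/(_ (rev_ord i) (rev_ord j)) := uQ.
  rewrite !mxE (inj_eq rev_ord_inj) => <-.
  by apply: eq_bigr => l _; rewrite !mxE.
- apply/is_trig_mxP => i j ltij; rewrite mxE tR //=.
  by have := ltn_ord j; lia.
- apply/matrixP => i j; have /matrixP/(_ i (rev_ord j)) := eM.
  rewrite !mxE rev_ordK => ->; rewrite (reindex_inj rev_ord_inj) /=.
  by apply: eq_bigr => l _; rewrite !mxE.
Qed.

(** Induction on the size, in the manner of Givens rotations: once the first column is cleared, the
    trailing block is again Hessenberg. The unitary factor [G *m D] is Hessenberg because [G] mixes
    only the first two rows, on which the Hessenberg condition imposes nothing. *)
Lemma hess_qr m (H : 'M[C]_m) : upper_hess 1 H ->
  exists Q R : 'M_m, [/\ Q \is unitarymx, upper_hess 1 Q,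
                         upper_triangular R & H = Q *m R].
Proof.
elim: m H => [|[|m] IHm] H hH.
- exists 1%:M, H; split; rewrite ?mul1mx //; try by case.
    by apply/unitarymxP; rewrite !thinmx0.
  by apply/upper_triangularP; case.
- exists 1%:M, H; split; rewrite ?mul1mx //.
  + exact: unitarymx1.
  + by move=> i j; rewrite !ord1.
  + by apply/upper_triangularP => i j; rewrite !ord1.
(* A unitary [g] acting on the first two rows clears the subdiagonal entry of
   the first column. *)
have [g [r [ug /upper_triangularP tr eHr]]] :=
  tall_qr (@ulsubmx _ 2 m 2 m H) (leqnn 2).
have {}ug : g \is unitarymx by apply/unitarymx_adjP.
pose G : 'M[C]_(2 + m) := block_mx g 0 0 1%:M.
have uG : G \is unitarymx by exact: unitary_block_diag ug (unitarymx1 _ _).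
have rowG (g' : 'M[C]_2) (M : 'M[C]_(2 + m)) (i j : 'I_(2 + m)) :
  (1 < i)%N -> ((block_mx g' 0 0 1%:M : 'M[C]_(2 + m)) *m M) i j = M i j.
  case: (split_ordP i) => i' -> /= hi; first by have := ltn_ord i'; lia.
  rewrite -[M]vsubmxK mul_block_col !mul0mx mul1mx add0r !col_mxEd.
  by [].
have eGa : G^t* = block_mx (g^t*) 0 0 1%:M.
  by rewrite adjmx_block !adjmx0 adjmx1.
(* The same matrix is split as [2 + m] for the action of [g] and as [1 + (1 + m)] for the recursion;
   the two sizes are convertible. *)
pose H' : 'M[C]_(2 + m) := H.
pose H1 : 'M[C]_(1 + (1 + m)) := G^t* *m H'.
have eH : H = G *m H1.
  by rewrite /H1 mulmxA (unitarymxP uG) mul1mx.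
have hH1 : upper_hess 1 H1.
  move=> i j ltij; rewrite /H1 eGa rowG ?hH //.
  by apply: leq_trans ltij; rewrite addn1.
have dl0 : dlsubmx H1 = 0.
  apply/matrixP => i j; rewrite [LHS]mxE [LHS]mxE [RHS]mxE ord1 {j}.
  (* Only the entry just below the corner needs [g]; the others vanish by the Hessenberg shape. *)
  have [i0|i0] := posnP i; last by apply: hH1 => /=; lia.
  have -> : @rshift 1 (1 + m) i = @lshift 2 m 1 :> 'I_(2 + m).
    by apply: val_inj; rewrite /= i0.
  have -> : @lshift 1 (1 + m) 0 = @lshift 2 m 0 :> 'I_(2 + m).
    exact: val_inj.
  rewrite /H1 eGa -[H'](@submxK _ 2 m 2 m) mulmx_block.
  rewrite (@block_mxEul _ 2 m 2 m) eHr mulmxA (unitarymx_adjP ug).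
  by rewrite mul1mx mul0mx addr0 tr.
have hH2 : upper_hess 1 (drsubmx H1).
  by move=> i j ltij; rewrite mxE mxE hH1 //=; lia.
have [Q [R [uQ hQ tR eQR]]] := IHm _ hH2.
pose D : 'M[C]_(1 + (1 + m)) := block_mx 1%:M 0 0 Q.
have hD : upper_hess 1 D := upper_hess_block_diag hQ.
have uD : D \is unitarymx by exact: unitary_block_diag (unitarymx1 _ _) uQ.
pose T : 'M[C]_(1 + (1 + m)) := block_mx (ulsubmx H1) (ursubmx H1) 0 R.
have tT : upper_triangular T.
  apply: upper_triangular_block => //; apply/upper_triangularP => i j.
  by rewrite !ord1.
have eD : D *m T = H1.
  rewrite mulmx_block !mul1mx !mul0mx !mulmx0 !addr0 !add0r -eQR -dl0.
  exact: submxK.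
exists (G *m D), T; split=> //.
- exact: (mul_unitarymx uG uD).
- move=> i j ltij; rewrite rowG ?hD //.
  by apply: leq_trans ltij; rewrite addn1.
- by rewrite eH -eD; exact: mulmxA.
Qed.

(** One shift [x] turns [A = Q R + x] into [R Q + x], again Hessenberg even if [R] is singular. If
    [P S] is the factorization for the remaining shifts at the new matrix, then [(Q P) (S R)] is one
    for all shifts at [A]. *)
Lemma hess_multishift m (s : seq C) (A : 'M[C]_m.+1) : upper_hess 1 A ->
  exists2 P, qr_unitary_factor (horner_mx A (\prod_(x <- s) ('X - x%:P))) P
           & upper_hess 1 (P^t* *m A *m P).
Proof.
elim: s A => [|x s IHs] A hA.
  have u1 := unitarymx1 C m.+1.
  exists 1%:M; last by rewrite adjmx1 mul1mx mulmx1.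
  split=> //; exists 1%:M; last by rewrite big_nil rmorph1 mulmx1.
  apply/upper_triangularP => i j ltij.
  by rewrite mxE -val_eqE gtn_eqF //= -[val j]addn0.
have [Q [R [uQ hQ tR eQR]]] :=
  hess_qr (upper_hess_add_scalar (- x) hA).
have eA : A = Q *m R + x%:M by rewrite -eQR raddfN addrNK.
have uQ' := unitarymx_adjP uQ.
have eA' : Q^t* *m A *m Q = R *m Q + x%:M.
  rewrite eA mulmxDr mulmxA uQ' mul1mx mulmxDl; congr (_ + _).
  by rewrite scalar_mxC -mulmxA uQ' mulmx1.
have hA' : upper_hess 1 (Q^t* *m A *m Q).
  rewrite eA'; apply: upper_hess_add_scalar.
  by apply: (upper_hessM (a := 0)) => //; exact/upper_triangularP.
have [P [uP [S tS eS]] hP] := IHs _ hA'.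
exists (Q *m P); last by rewrite adjmxM -!mulmxA; rewrite -!mulmxA in hP.
split; first exact: mul_unitarymx.
exists (S *m R); first exact: upper_triangularM.
rewrite big_cons mulrC rmorphM rmorphB /= horner_mx_X horner_mx_C.
have -> : A - x%:M = Q *m R by rewrite eA addrK.
set f := \prod_(_ <- _) _ in eS *.
(* Polynomials commute with conjugation, so the unitary factor [Q] can be moved to the left of the
   remaining shifts. *)
have eQ : horner_mx A f *m Q = Q *m horner_mx (Q^t* *m A *m Q) f.
  rewrite -(invmx_unitary uQ) horner_mx_uconjC ?unitarymx_unit //.
  by rewrite -mulmxA mulKVmx ?unitarymx_unit.
by rewrite -[_ * _]/(_ *m _) !mulmxA eQ eS !mulmxA.
Qed.

End QR.

(** * The factorization of an embedded proper Hessenberg matrix *)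

Section LFR.
Variable C : numClosedFieldType.

Lemma castmx_unitary m n (e : m = n) (A : 'M[C]_m) :
  (castmx (e, e) A \is unitarymx) = (A \is unitarymx).
Proof. by case: n / e; rewrite castmx_id. Qed.

Lemma cast_rshiftP N k n (e : (k + n = N)%N) (j : 'I_N) : (k <= j)%N ->
  exists j' : 'I_n, j = cast_ord e (rshift k j').
Proof.
case: N / e j => j; case: (split_ordP j) => j' -> /= lekj.
  by have := ltn_ord j'; lia.
by exists j'; apply: val_inj.
Qed.

(** [R] is defined so that [Q R] equals the adjoint of [L] times [V]: hence [L Q R = V]. In the
    low-rank term the factor [R] inside [Z = R W] cancels against the final [R] by unitarity. A
    general size [N] lets the cast be eliminated. *)
Lemma lfr_assemble N k n (e : (k + n = N)%N) (V : 'M[C]_N) (W L1 : 'M_(N, k))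
    (L2 : 'M_(N, n)) (T : 'M_k) (Qh : 'M_n) :
  V \is unitarymx -> Qh \is unitarymx ->
  L1^t* *m L1 = 1%:M -> L2^t* *m L2 = 1%:M -> L1^t* *m L2 = 0 ->
  let L := castmx (erefl N, e) (row_mx L1 L2) in
  let Q := castmx (e, e) (block_mx 1%:M 0 0 Qh) in
  let R := Q^t* *m L^t* *m V in
  let F := Q + castmx (e, erefl k) (col_mx T 0) *m (R *m W)^t* in
  [/\ L \is unitarymx, R \is unitarymx,
      V + L1 *m T *m W^t* = L *m F *m R,
      forall i j, L i (cast_ord e (rshift k j)) = L2 i j
    & forall i j, R (cast_ord e (rshift k i)) j = (Qh^t* *m L2^t* *m V) i j].
Proof.
case: N / e V W L1 L2 => V W L1 L2 uV uQh o11 o22 o12.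
rewrite !castmx_id.
set L := row_mx _ _; set Q := block_mx _ _ _ _; move=> L' Q' R F.
have u1 := unitarymx1 C k.
have uL : L \is unitarymx.
  apply/unitarymx_adjP; rewrite adjmx_row mul_col_row o11 o22 o12.
  have -> : L2^t* *m L1 = 0 by rewrite -[L1]trmxCK -adjmxM o12 adjmx0.
  by rewrite -scalar_mx_block.
have uQ : Q \is unitarymx by exact: unitary_block_diag.
have eR : Q *m R = L^t* *m V.
  by rewrite /R /Q' 2!mulmxA (unitarymxP uQ) mul1mx.
have uR : R \is unitarymx.
  by rewrite !mul_unitarymx // trmxC_unitary.
split=> //.
- have -> : L' *m F *m R =
      L *m (Q *m R) + L *m col_mx T 0 *m W^t* *m (R^t* *m R).
    by rewrite /F adjmxM mulmxDr mulmxDl !mulmxA.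
  rewrite eR mulmxA (unitarymxP uL) mul1mx (unitarymx_adjP uR) mulmx1.
  by rewrite mul_row_col mulmx0 addr0.
- by move=> i j; rewrite cast_ord_id row_mxEr.
- move=> i j; rewrite cast_ord_id /R /Q' /L' -!mulmxA adjmx_row mul_col_mx.
  rewrite adjmx_block !adjmx0 mul_block_col !mul0mx add0r.
  by rewrite col_mxEd.
Qed.

Lemma embedded_unitary n k (U : 'M[C]_n) (Y : 'M_(n, k)) :
  U \is unitarymx -> Y^t* *m Y = 1%:M ->
  block_mx (U - U *m Y *m Y^t*) (U *m Y) (Y^t*) 0 \is unitarymx.
Proof.
move=> uU oY; apply/unitarymx_adjP.
have uU' := unitarymx_adjP uU.
have UYY : U - U *m Y *m Y^t* = U *m (1%:M - Y *m Y^t*).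
  by rewrite mulmxBr mulmx1 mulmxA.
have YY : (1%:M - Y *m Y^t*) *m Y = 0.
  by rewrite mulmxBl mul1mx -mulmxA oY mulmx1 subrr.
have sa : (1%:M - Y *m Y^t*)^t* = 1%:M - Y *m Y^t*.
  by rewrite adjmxB adjmx1 adjmxM trmxCK.
rewrite UYY adjmx_block adjmx0 trmxCK mulmx_block !adjmxM sa.
have -> : (1%:M - Y *m Y^t*) *m U^t* *m (U *m (1%:M - Y *m Y^t*))
    = 1%:M - Y *m Y^t*.
  rewrite mulmxA -[_ *m U]mulmxA uU' mulmx1 mulmxBr mulmx1 mulmxA YY mul0mx.
  by rewrite subr0.
have -> : (1%:M - Y *m Y^t*) *m U^t* *m (U *m Y) = 0.
  by rewrite mulmxA -[_ *m U]mulmxA uU' mulmx1.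
have -> : Y^t* *m U^t* *m (U *m Y) = 1%:M.
  by rewrite mulmxA -[_ *m U]mulmxA uU' mulmx1.
have -> : Y^t* *m U^t* *m (U *m (1%:M - Y *m Y^t*)) = 0.
  rewrite mulmxA -[_ *m U]mulmxA uU' mulmx1 mulmxBr mulmx1 mulmxA oY.
  by rewrite mul1mx subrr.
by rewrite subrK !mulmx0 mul0mx !addr0 -scalar_mx_block.
Qed.

Lemma lower_null_basis n k (X : 'M[C]_(n, k)) :
  exists L2 : 'M_(n + k, n),
  [/\ L2^t* *m L2 = 1%:M, (col_mx X (- 1%:M))^t* *m L2 = 0,
      is_trig_mx (usubmx L2) & usubmx L2 \in unitmx].
Proof.
have [L2 [G [oL tG eM]]] :=
  tall_ql (col_mx (1%:M : 'M_n) (X^t*)) (leq_addr k n).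
have e1 : usubmx L2 *m G = 1%:M.
  by rewrite mul_usub_mx -eM col_mxKu.
have [uL uG] := mulmx1_unit e1.
exists L2; split=> //.
- have : (col_mx X (- 1%:M))^t* *m (L2 *m G) = 0.
    rewrite -eM adjmx_col mul_row_col mulmx1 raddfN /= map_mxN adjmx1 mulNmx.
    by rewrite mul1mx subrr.
  by move/(congr1 (mulmx^~ (invmx G))); rewrite mulmxA mulmxK // mul0mx.
- have hG : upper_triangular G^T by rewrite /upper_triangular trmxK.
  have : upper_hess 0 (usubmx L2)^T.
    apply: (upper_hess_divr hG); first by rewrite unitmx_tr.
    rewrite -trmx_mul (mulmx1C e1) trmx1; apply/upper_triangularP.
    by rewrite /upper_triangular trmx1 scalar_mx_is_trig.
  by move/upper_triangularP; rewrite /upper_triangular trmxK.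
Qed.

(** The last [n] rows of [R] begin with [R1], so the [k]-th subdiagonal of [R] is the diagonal of
    [R1]. Properness of [A] controls all of it but the last entry, which is nonzero when [A], hence
    [Qh *m R1 = G *m A], is nonsingular. *)
Lemma embedded_lfr n k (A U : 'M[C]_n) (X Y : 'M_(n, k)) :
  A = U + X *m Y^t* -> U \is unitarymx -> Y^t* *m Y = 1%:M ->
  proper_upper_hess 1 A ->
  exists L F R, lfr_factorization (block_mx A (U *m Y) 0 0) L F R /\
                (A \in unitmx -> proper_upper_hess k R).
Proof.
move=> eA uU oY [hA pA].
pose V := block_mx (U - U *m Y *m Y^t*) (U *m Y) (Y^t*) 0.
pose W := col_mx Y (0 : 'M_k).
pose Xh := col_mx (X + U *m Y) (- 1%:M).
have uV : V \is unitarymx by exact: embedded_unitary.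
have eAh : block_mx A (U *m Y) 0 0 = V + Xh *m W^t*.
  rewrite adjmx_col adjmx0 mul_col_row !mulmx0 mulNmx mul1mx add_block_mx.
  by rewrite !addr0 subrr mulmxDl [X *m _ + _]addrC addrA subrK eA.
have [L1 [T [oL1 tT eX]]] := tall_qr Xh (leq_addl n k).
have [L2 [oL2 XL2 tL2 uL2]] := lower_null_basis (X + U *m Y).
(* The bottom block of [Xh] is minus the identity, and [T] is a right factor of it. *)
have uT : T \in unitmx.
  have : dsubmx Xh = dsubmx L1 *m T by rewrite mul_dsub_mx -eX.
  rewrite col_mxKd => /(congr1 -%R); rewrite opprK -mulNmx => /esym.
  by move=> /mulmx1_unit[].
have oL12 : L1^t* *m L2 = 0.
  move: XL2; rewrite -/Xh eX adjmxM -mulmxA.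
  move/(congr1 (mulmx (invmx (T^t*)))); rewrite mulmx0 mulKmx //.
  by rewrite map_unitmx unitmx_tr.
(* Since [L2] is orthogonal to [Xh], [V] may be replaced by the embedded matrix, whose zero bottom
   rows leave only the top block of [L2]. *)
have L2V : L2^t* *m V = row_mx ((usubmx L2)^t* *m A) ((usubmx L2)^t* *m U *m Y).
  transitivity (L2^t* *m (block_mx A (U *m Y) 0 0)).
    rewrite eAh mulmxDr mulmxA -[Xh]trmxCK -adjmxM XL2 adjmx0 mul0mx addr0.
    by [].
  rewrite -[L2 in LHS]vsubmxK adjmx_col mul_row_block !mulmx0 !addr0.
  by rewrite mulmxA.
set G := (usubmx L2)^t* in L2V *.
have tG : upper_triangular G := upper_triangular_adj tL2.
have uG : G \in unitmx by rewrite map_unitmx unitmx_tr.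
have hG := upper_triangularP _ tG.
have [Qh [R1 [uQ hQ tR eQR]]] := hess_qr (upper_hessM hG hA).
have hR := upper_triangularP _ tR.
(* Both factors inherit nonzero entries from the subdiagonal of [G *m A]. *)
have sub_neq0 (i j : 'I_n) : i = (j + 1)%N :> nat ->
    Qh i j != 0 /\ R1 j j != 0.
  move=> ij; apply/andP; rewrite -negb_or -mulf_eq0.
  rewrite -(upper_hess_mul_diag hQ hR ij) ?addn0 // -eQR.
  rewrite (upper_hess_mul_diag (l := i) hG hA) ?addn0 // mulf_neq0 //.
    exact: upper_triangular_unit_diag.
  exact: pA.
have [] := lfr_assemble (addnC k n) W T uV uQ oL1 oL2 oL12.
set L := castmx _ (row_mx _ _); set Q := castmx _ (block_mx _ _ _ _).
move=> uL uR; set R := Q^t* *m _ *m _ in uR *; set F := Q + _ => eLFR Lr Rr.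
have Rl (i j : 'I_n) :
    R (cast_ord (addnC k n) (rshift k i)) (lshift k j) = R1 i j.
  rewrite Rr -mulmxA L2V mul_mx_row row_mxEl eQR mulmxA.
  by rewrite (unitarymx_adjP uQ) mul1mx.
have hessR : upper_hess k R.
  move=> i j ltij.
  have [i' ei] : exists i', i = cast_ord (addnC k n) (rshift k i').
    by apply: cast_rshiftP; clear -ltij; lia.
  rewrite ei in ltij *; case: (split_ordP j) ltij => j' -> /= ltij.
    by rewrite Rl hR //; clear -ltij; lia.
  by clear -ltij; have := ltn_ord i'; lia.
have diagR (i j : 'I_(n + k)) : i = (j + k)%N :> nat ->
    exists j' : 'I_n, j = j' :> nat /\ R i j = R1 j' j'.
  move=> ij.
  have [i' ei] : exists i', i = cast_ord (addnC k n) (rshift k i').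
    by apply: cast_rshiftP; clear -ij; lia.
  rewrite ei in ij *; case: (split_ordP j) ij => j' -> /= ij; last first.
    by clear -ij; have := ltn_ord i'; lia.
  have -> : i' = j' by apply: val_inj => /=; clear -ij; lia.
  by exists j'; rewrite Rl.
exists L, F, R; split; last first.
  move=> uA; split=> // i j /diagR[j' [_ ->]].
  apply: upper_triangular_unit_diag => //.
  have : Qh *m R1 \in unitmx by rewrite -eQR unitmx_mul uG.
  by rewrite unitmx_mul => /andP[].
split.
- by rewrite eAh eX.
- split=> //; split=> i j.
    move=> ltij; have [j' ej] :
        exists j', j = cast_ord (addnC k n) (rshift k j').
      by apply: cast_rshiftP; clear -ltij; lia.
    rewrite ej Lr in ltij *; case: (split_ordP i) ltij => i' -> /= ltij.
      move/is_trig_mxP: tL2 => /(_ i' j'); rewrite mxE; apply.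
      by clear -ltij; lia.
    by clear -ltij; have := ltn_ord j'; lia.
  move=> ij; have [j' ej] : exists j', j = cast_ord (addnC k n) (rshift k j').
    by apply: cast_rshiftP; clear -ij; lia.
  rewrite ej Lr in ij *; case: (split_ordP i) ij => i' -> /= ij; last first.
    by clear -ij; have := ltn_ord j'; lia.
  have -> : i' = j' by apply: val_inj => /=; clear -ij; lia.
  have tL2' : upper_triangular (usubmx L2)^T by rewrite /upper_triangular trmxK.
  have := upper_triangular_unit_diag j' tL2'.
  by rewrite unitmx_tr mxE mxE; apply.
- by [].
- move=> i j /diagR[j' [ejj' ->]] ltjn.
  (* The bound provides a row just below [j'], as [sub_neq0] requires. *)
  have ltj'n : (j'.+1 < n)%N by clear -ejj' ltjn; lia.
  by have [] := sub_neq0 (Ordinal ltj'n) j' (esym (addn1 _)).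
- exists Qh, T, (R *m W); split=> //.
  + split; first by rewrite castmx_unitary unitary_block_diag ?unitarymx1.
    exact/upper_hess_castmx/upper_hess_block_diag.
  + by split=> // i j /sub_neq0[].
  (* [R *m W] has orthonormal columns, as [R] is unitary and [W] is [Y] padded with zeros. *)
  + apply/eqP; rewrite -mxrank_tr -(mxrank_map Num.conj); apply/eqP.
    apply: mxrank_unitary; apply/unitarymxP; rewrite trmxCK adjmxM -mulmxA.
    rewrite [_ *m (R *m W)]mulmxA (unitarymx_adjP uR) mul1mx.
    by rewrite adjmx_col mul_row_col oY mulmx0 addr0.
Qed.

End LFR.

(** * The QR step on the embedded matrix *)

Section EmbeddedStep.
Variable C : numClosedFieldType.

Lemma horner_mx_block_ul n k (A : 'M[C]_n.+1) (B : 'M_(n.+1, k)) p :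
  exists D, @horner_mx C (n + k) (block_mx A B 0 0) p
          = block_mx (horner_mx A p) D 0 p.[0]%:M.
Proof.
elim/poly_ind: p => [|p c [D IHp]].
  by exists 0; rewrite !rmorph0 horner0 raddf0 block_mx0.
rewrite hornerMXaddC mulr0 add0r !rmorphD !rmorphM /= !horner_mx_X !horner_mx_C.
rewrite IHp.
exists (horner_mx A p *m B).
(* The ring operations at size [(n + k).+1] are restated as matrix operations at the convertible
   size [n.+1 + k], where the blocks are visible. *)
change (block_mx (horner_mx A p) D 0 p.[0]%:M *m block_mx A B 0 0 + c%:M
  = block_mx (horner_mx A p *m A + c%:M) (horner_mx A p *m B) 0 (c%:M : 'M_k)).
rewrite mulmx_block scalar_mx_block add_block_mx.
by rewrite !mulmx0 !mul0mx !addr0 !add0r.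
Qed.

Lemma embed_AE n k (A U : 'M[C]_n) (X Y QY : 'M_(n, k)) (RY : 'M_k) :
  A = U + X *m Y^t* -> Y = QY *m RY ->
  embed_A U X QY RY = block_mx A (U *m QY) 0 0.
Proof.
move=> -> ->; rewrite /embed_A /embed_U /embed_X /embed_Y /embed_B.
rewrite adjmx_col adjmx0 mul_col_row !mulmx0 mulNmx mul1mx add_block_mx.
rewrite !addr0 subrr mulmxDl [X *m _ *m _ + _]addrC addrA subrK adjmxM.
by rewrite mulmxA.
Qed.

(** Conjugation by [P] replaces [U] and [QY] by [U1] and [Y1], again unitary and with orthonormal
    columns respectively; the result is therefore an embedding of [A1]. *)
Lemma embedded_step n k (A U : 'M[C]_n) (X Y QY : 'M_(n, k)) (RY : 'M_k)
    (P1 : 'M_n) (P2 : 'M_k) :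
  A = U + X *m Y^t* -> Y = QY *m RY -> U \is unitarymx ->
  QY^t* *m QY = 1%:M -> P1 \is unitarymx -> P2 \is unitarymx ->
  let A1 := P1^t* *m A *m P1 in
  let P := block_mx P1 0 0 P2 in
  exists B1,
  P^t* *m block_mx A (U *m QY) 0 0 *m P = block_mx A1 B1 0 0 /\
  (proper_upper_hess 1 A1 ->
   exists L F R, lfr_factorization (block_mx A1 B1 0 0) L F R /\
                 (A \in unitmx -> proper_upper_hess k R)).
Proof.
move=> eA eY uU oQ uP1 uP2 A1 P.
have P1K := unitarymxP uP1; have P2K := unitarymxP uP2.
pose U1 := P1^t* *m U *m P1; pose Y1 := P1^t* *m QY *m P2.
pose X1 := P1^t* *m X *m RY^t* *m P2.
have eB : U1 *m Y1 = P1^t* *m (U *m QY) *m P2.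
  by rewrite /U1 /Y1 !mulmxA -[_ *m P1 *m P1^t*]mulmxA P1K mulmx1.
have eA1 : A1 = U1 + X1 *m Y1^t*.
  rewrite /A1 eA eY mulmxDr mulmxDl /X1 /Y1 !adjmxM trmxCK.
  rewrite !mulmxA; congr (_ + _).
  by rewrite -[_ *m P2 *m P2^t*]mulmxA P2K mulmx1.
have uU1 : U1 \is unitarymx by rewrite !mul_unitarymx // trmxC_unitary.
have oY1 : Y1^t* *m Y1 = 1%:M.
  rewrite /Y1 !adjmxM trmxCK !mulmxA -[_ *m P1 *m P1^t*]mulmxA P1K mulmx1.
  by rewrite -[_ *m QY^t* *m QY]mulmxA oQ mulmx1 (unitarymx_adjP uP2).
exists (U1 *m Y1); split.
  rewrite adjmx_block !adjmx0 !mulmx_block !mulmx0 !mul0mx !addr0 !add0r eB.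
  by rewrite !mul0mx.
move=> /(embedded_lfr eA1 uU1 oY1)[L [F [R [hLFR hR]]]].
exists L, F, R; split=> // uA; apply: hR.
by rewrite !unitmx_mul uA unitarymx_unit ?trmxC_unitary ?unitarymx_unit.
Qed.

(** The first block column makes the square block [P1] unitary; the second, being orthogonal to it,
    must have [B = 0]. *)
Lemma unitary_block_triangular m n (P1 : 'M[C]_m) B (P2 : 'M_n) :
  block_mx P1 B 0 P2 \is unitarymx ->
  [/\ P1 \is unitarymx, B = 0 & P2 \is unitarymx].
Proof.
move=> /unitarymx_adjP; rewrite adjmx_block adjmx0 mulmx_block.
rewrite !mul0mx !mulmx0 !addr0 scalar_mx_block.
case/eq_block_mx => P1K P1B _ P2K.
have uP1 : P1 \is unitarymx by apply/unitarymx_adjP.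
have B0 : B = 0.
  by rewrite -[B]mul1mx -(unitarymxP uP1) -mulmxA P1B mulmx0.
split=> //; apply/unitarymx_adjP.
by rewrite B0 adjmx0 mul0mx add0r in P2K.
Qed.

End EmbeddedStep.

(* The order of A is n.+1. *)
Theorem theorem4 (K : realType) (n k d : nat)
    (A U : 'M[K[i]]_n.+1) (X Y QY : 'M[K[i]]_(n.+1, k)) (RY : 'M[K[i]]_k)
    (p : {poly K[i]}) :
  A = U + X *m Y^t* ->
  proper_upper_hess 1 A ->
  U \is unitarymx ->
  \rank X = k ->
  \rank Y = k ->
  economy_qr Y QY RY ->
  p \is monic ->
  size p = d.+1 ->
  let Ahat := embed_A U X QY RY in
  let pAhat : 'M[K[i]]_(n.+1 + k) := @horner_mx K[i] (n + k) Ahat p in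
  let claim (P : 'M[K[i]]_(n.+1 + k)) :=
    let Ahat1 := P^t* *m Ahat *m P in
    exists (A1 : 'M[K[i]]_n.+1) (B1 : 'M[K[i]]_(n.+1, k)),
    [/\ Ahat1 = block_mx A1 B1 0 0,
        multishift_qr_step p A A1,
        upper_hess 1 Ahat1,
        upper_hess 1 A1
      & proper_upper_hess 1 A1 ->
        exists L F R : 'M[K[i]]_(n.+1 + k),
          lfr_factorization Ahat1 L F R /\
          (A \in unitmx -> proper_upper_hess k R)] in
  (* If no shift is an eigenvalue of A, every unitary factor works; otherwise
     the factor is not essentially unique and has to be chosen. *)
  (horner_mx A p \in unitmx ->
     forall P : 'M[K[i]]_(n.+1 + k), qr_unitary_factor pAhat P -> claim P) /\
  (exists2 P : 'M[K[i]]_(n.+1 + k), qr_unitary_factor pAhat P & claim P).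
Proof.
move=> eA pA uU _ _ [oQ _ eY] mp _ Ahat pAhat claim.
have eAh : Ahat = block_mx A (U *m QY) 0 0 := embed_AE eA eY.
have [D epAh] := horner_mx_block_ul A (U *m QY) p.
have {}epAh : pAhat = block_mx (horner_mx A p) D 0 p.[0]%:M.
  by rewrite /pAhat eAh epAh.
have tS : upper_triangular (p.[0]%:M : 'M_k).
  by rewrite /upper_triangular tr_scalar_mx scalar_mx_is_trig.
have step P1 P2 : qr_unitary_factor (horner_mx A p) P1 -> P2 \is unitarymx ->
    upper_hess 1 (P1^t* *m A *m P1) -> claim (block_mx P1 0 0 P2).
  move=> qrP1 uP2 hA1; have [uP1 _] := qrP1.
  have [B1 [eA1 hB1]] := embedded_step eA eY uU oQ uP1 uP2.
  exists (P1^t* *m A *m P1), B1; rewrite eAh eA1; split=> //.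
  - by exists P1.
  - exact: upper_hess_block_ul.
split=> [upA P [uP [S tSP eS]]|].
  rewrite epAh in eS.
  move: uP tSP eS; rewrite -[P]submxK -[S]submxK.
  move: (ulsubmx P) (ursubmx P) (dlsubmx P) (drsubmx P) => P1 P12 P21 P2.
  move: (ulsubmx S) (ursubmx S) (dlsubmx S) (drsubmx S) => S1 S12 S21 S2.
  move=> uP; rewrite {1}/upper_triangular tr_block_mx is_trig_block_mx //.
  case/and3P => /eqP; rewrite -[0]trmx0 => /trmx_inj -> tS1 _.
  rewrite mulmx_block !mulmx0 !addr0 => /eq_block_mx[eS1 _ eS21 _].
  have uS1 : S1 \in unitmx by move: upA; rewrite eS1 unitmx_mul => /andP[].
  (* The lower left block of [pAhat] is zero and [S1] is invertible, so [P] is block triangular,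
     hence block diagonal. *)
  have P21_0 : P21 = 0 by rewrite -[P21](mulmxK uS1) -eS21 mul0mx.
  rewrite P21_0 in uP *.
  have [uP1 -> uP2] := unitary_block_triangular uP.
  apply: step => //; first by split=> //; exists S1.
  (* [A] commutes with its polynomial [P1 *m S1], so the new matrix times [S1] is [S1 *m A], which
     is Hessenberg. *)
  apply: (upper_hess_divr tS1 uS1).
  have -> : P1^t* *m A *m P1 *m S1 = S1 *m A.
    rewrite -mulmxA -eS1 -mulmxA.
    have -> : A *m horner_mx A p = horner_mx A p *m A.
      exact/esym/comm_horner_mx.
    by rewrite eS1 !mulmxA (unitarymx_adjP uP1) mul1mx.
  by apply: (upper_hessM (a := 0)); [exact/upper_triangularP | case: pA].
(* Splitting [p] into linear factors gives the shifts, from which a Hessenberg-preserving [P1] is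
   built even for singular [horner_mx A p]. *)
have [s es] := closed_field_poly_normal p.
rewrite (monicP mp) scale1r in es.
have [P1 qrP1 hA1] := hess_multishift s (proj1 pA).
rewrite -es in qrP1.
have u1 := unitarymx1 K[i] k.
exists (block_mx P1 0 0 1%:M); last exact: step.
have [uP1 [R tR eR]] := qrP1.
split; first exact: unitary_block_diag.
exists (block_mx R (P1^t* *m D) 0 p.[0]%:M).
  exact: upper_triangular_block.
rewrite epAh mulmx_block !mul0mx !mulmx0 !addr0 add0r mul1mx -eR mulmxA.
by rewrite (unitarymxP uP1) mul1mx.
Qed.
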